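(* Let $\mathcal{H}=\mathcal{H}(\Omega)$ be a reproducing kernel Hilbert space of functions analytic in a domain $\Omega\subset\mathbb{C}$, with kernel $p$ and norm $\|\cdot\|$. Let $\Gamma\Subset\Omega$ be a rectifiable curve of finite length and let $\|\cdot\|_\Gamma$ be the $L^2(\Gamma,|d\tau|)$ norm. Let $\epsilon>0$ and fix a point $z\in\Omega\setminus\mathrm{cl}(\Gamma)$. If $f\in\mathcal{H}$ satisfies $\|f\|\le1$ and $\|f\|_\Gamma\le\epsilon$, then $$|f(z)|\le\frac32\,u_{\epsilon,z}(z)\min\left\{\frac{1}{\|u_{\epsilon,z}\|},\frac{\epsilon}{\|u_{\epsilon,z}\|_\Gamma}\right\},$$ where $u_{\epsilon,z}\in\mathcal{H}$ is the unique solution of $$\mathcal{K}u+\epsilon^2u=p_z.$$ Moreover, the bound is optimal, since it is attained (up to the factor $3/2$) by $$M_{\epsilon,z}(\zeta)=u_{\epsilon,z}(\zeta)\min\left\{\frac{1}{\|u_{\epsilon,z}\|},\frac{\epsilon}{\|u_{\epsilon,z}\|_\Gamma}\right\},$$ that is, $M_{\epsilon,z}\in\mathcal{H}$, $\|M_{\epsilon,z}\|\le1$, $\|M_{\epsilon,z}\|_\Gamma\le\epsilon$, and $M_{\epsilon,z}(z)$ equals the right-hand side of the bound divided by $3/2$.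
   Context: A reproducing kernel Hilbert space (RKHS) of functions on $\Omega$ is a complex Hilbert space of functions with inner product $(\cdot,\cdot)$ (linear in the first argument) for which each point evaluation $f\mapsto f(\tau)$, $\tau\in\Omega$, is continuous; $p_\tau\in\mathcal{H}$ denotes the element with $f(\tau)=(f,p_\tau)$ for all $f\in\mathcal{H}$, and the kernel is $p(\zeta,\tau)=p_\tau(\zeta)$. $\Gamma\Subset\Omega$ means that $\mathrm{cl}(\Gamma)$ is a compact subset of $\Omega$; $|d\tau|$ is arc length measure. The operator $\mathcal{K}:\mathcal{H}\to\mathcal{H}$ is $$(\mathcal{K}f)(\zeta)=\int_\Gamma p(\zeta,\tau)f(\tau)\,|d\tau|,\qquad\zeta\in\Omega,$$ equivalently $(\mathcal{K}f,g)=(f,g)_{L^2(\Gamma)}$ for all $f,g\in\mathcal{H}$. In the degenerate case $p_z=0$ (so $u_{\epsilon,z}=0$), the right-hand side of the bound and $M_{\epsilon,z}$ are read as $0$. *)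

(* Defs.v *)
From HB Require Import structures.
From mathcomp Require Import all_boot all_order all_algebra.
From mathcomp Require Import all_classical all_reals all_analysis.
From mathcomp Require Import complex.

Set Implicit Arguments.
Unset Strict Implicit.
Unset Printing Implicit Defensive.

Import Order.TTheory GRing.Theory Num.Theory.
Import numFieldNormedType.Exports.
Import ComplexField.Normc.

Local Open Scope classical_set_scope.
Local Open Scope ring_scope.
Local Open Scope complex_scope.

Section curve_length.
Context {R : realType}.
Implicit Types (g : R -> R[i]) (D E : set R) (s : seq R) (x y t : R).

Definition polygon_length g s : R :=
  \sum_(p <- zip s (behead s)) normc (g p.2 - g p.1).

Definition curve_length g D : \bar R :=
  ereal_sup [set (polygon_length g s)%:E
            | s in [set s | sorted <=%R s /\ {in s, forall t, D t}]].

Lemma normc_ge0 (z : R[i]) : 0 <= normc z.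
Proof. by case: z => a b; exact: sqrtr_ge0. Qed.

Lemma normc_distD (a b c : R[i]) :
  normc (a - c) <= normc (a - b) + normc (b - c).
Proof. by rewrite -[a - c](subrKA b) le_normcD. Qed.

Lemma polygon_length_ge0 g s : 0 <= polygon_length g s.
Proof. by apply: sumr_ge0 => p _; exact: normc_ge0. Qed.

Lemma polygon_length0 g : polygon_length g [::] = 0.
Proof. by rewrite /polygon_length big_nil. Qed.

Lemma polygon_length1 g x : polygon_length g [:: x] = 0.
Proof. by rewrite /polygon_length big_nil. Qed.

Lemma polygon_length_cons2 g x y s :
  polygon_length g [:: x, y & s] =
  normc (g y - g x) + polygon_length g (y :: s).
Proof. by rewrite /polygon_length/= big_cons. Qed.

Lemma polygon_length_rcons_cat g s1 x y s2 :
  polygon_length g (rcons s1 x ++ y :: s2) =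
  polygon_length g (rcons s1 x) + normc (g y - g x) + polygon_length g (y :: s2).
Proof.
elim: s1 => [|a [|b s1] ih] /=.
- by rewrite polygon_length_cons2 polygon_length1 add0r.
- by rewrite !polygon_length_cons2 polygon_length1 addr0 addrA.
- by move: ih => /=; rewrite !(polygon_length_cons2 g a) => ->; rewrite !addrA.
Qed.

Lemma polygon_length_catr g s1 s2 :
  polygon_length g s1 + polygon_length g s2 <= polygon_length g (s1 ++ s2).
Proof.
case/lastP: s1 => [|s1 x]; first by rewrite polygon_length0 add0r.
case: s2 => [|y s2]; first by rewrite cats0 polygon_length0 addr0.
by rewrite polygon_length_rcons_cat lerD2r lerDl normc_ge0.
Qed.

Lemma polygon_length_le g D s : sorted <=%R s -> {in s, forall t, D t} ->
  ((polygon_length g s)%:E <= curve_length g D)%E.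
Proof. by move=> ss sD; apply: ereal_sup_ubound; exists s. Qed.

Lemma curve_length_ge0 g D : (0 <= curve_length g D)%E.
Proof.
by apply: le_trans (@polygon_length_le g D [::] _ _) => //;
  rewrite polygon_length0.
Qed.

Lemma le_curve_length g D E : D `<=` E ->
  (curve_length g D <= curve_length g E)%E.
Proof.
move=> DE; apply: ge_ereal_sup => _ [s [ss sD] <-].
by apply: polygon_length_le => // t /sD; exact: DE.
Qed.

End curve_length.

Record rectifiable_curve (R : realType) := RectifiableCurve {
  curve_dom : set R ;
  curve_fun : R -> R[i] ;
  curve_dom_itv : is_interval curve_dom ;
  curve_dom_neq0 : curve_dom !=set0 ;
  curve_continuous : {within curve_dom, continuous (curve_fun : R -> R[i]^o)} ;
  curve_length_lty : (curve_length curve_fun curve_dom < +oo)%E }.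

Section arc_length.
Context {R : realType} (G : rectifiable_curve R).
Local Notation g := (curve_fun G).
Local Notation D := (curve_dom G).

Definition curve_trace : set R[i] := g @` D.

Definition arc_length (t : R) : R :=
  fine (curve_length g (D `&` [set s | s <= t])).

Let length_fin E : E `<=` D -> curve_length g E \is a fin_num.
Proof.
move=> ED; rewrite ge0_fin_numE ?curve_length_ge0//.
exact: le_lt_trans (le_curve_length g ED) (curve_length_lty G).
Qed.

Let polygon_le E s : E `<=` D -> sorted <=%R s -> {in s, forall t, E t} ->
  polygon_length g s <= fine (curve_length g E).
Proof.
by move=> ED ss sE; rewrite -lee_fin fineK ?length_fin// polygon_length_le.
Qed.

Lemma arc_length_nondecreasing : nondecreasing arc_length.
Proof.
move=> x y xy; apply: fine_le; rewrite ?length_fin//; try exact: subIsetl.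
by apply: le_curve_length => t [Dt tx]; split => //; exact: le_trans xy.
Qed.

Lemma arc_length_right_continuous : right_continuous arc_length.
Proof.
move=> x; apply/(@cvgrPdist_le _ R^o) => e e0.
have e20 : 0 < e / 2 by rewrite divr_gt0.
pose E := D `&` [set s | x < s].
have ED : E `<=` D by exact: subIsetl.
(* near x on the right the remaining part of the curve is short *)
have [r xr Hr] : exists2 r, x < r & forall s, sorted <=%R s ->
    {in s, forall t, E t /\ t < r} -> polygon_length g s <= e / 2.
  have [[d [Dd xd]]|nE] := pselect (E !=set0); last first.
    exists (x + 1); rewrite ?ltrDl// => -[|t s] _ sE.
      by rewrite polygon_length0 ltW.
    by exfalso; apply: nE; exists t; have [] := sE t (mem_head _ _).
  have [_ [s0 [ss0 s0E] <-]] := ub_ereal_sup_adherent e20 (length_fin ED).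
  rewrite -/(curve_length g E) -[curve_length g E]fineK ?length_fin// lte_fin => s0e.
  have {s0 ss0 s0E s0e} [h [s [ss sE se]]] : exists h s,
     [/\ sorted <=%R (h :: s), {in h :: s, forall t, E t} &
      fine (curve_length g E) - e / 2 < polygon_length g (h :: s)].
    case: s0 ss0 s0E s0e => [|h s] ss sE se; last by exists h, s.
    exists d, [::]; split; rewrite ?polygon_length1 -?(polygon_length0 g)//.
    by move=> t; rewrite inE => /eqP ->.
  exists h; first by have [] := sE h (mem_head _ _).
  move=> r sr rE; rewrite -(lerD2r (polygon_length g (h :: s))).
  apply: le_trans (polygon_length_catr g r (h :: s)) _.
  apply: le_trans (_ : fine (curve_length g E) <= _); last first.
    by rewrite -lerBlDl ltW.
  apply: polygon_le => //.
    case/lastP: r sr rE => [//|r u] sr rE.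
    rewrite cat_rcons sorted_cat_cons sr/=; apply/andP; split => //.
    by apply/ltW/(rE u _).2; rewrite mem_rcons mem_head.
  by move=> t; rewrite mem_cat => /orP[/rE[]//|/sE].
have [r' xr' Hr'] : exists2 r', x < r' & D x ->
    forall y, D y -> x < y < r' -> normc (g y - g x) <= e / 2.
  have [Dx|nDx] := pselect (D x); last by exists (x + 1); rewrite ?ltrDl.
  have /(@cvgrPdist_le _ R[i]^o)/(_ (e / 2)%:C) :=
    proj1 (@subspace_continuousP _ _ _ _) (@curve_continuous _ G) x Dx.
  rewrite ltcR => /(_ e20) [d /= d0 Hd]; exists (x + d); rewrite ?ltrDl// => _ y Dy.
  move=> /andP[xy yxd]; rewrite -lecR -normcN opprB; apply: Hd => //=.
  by rewrite distrC gtr0_norm ?subr_gt0// ltrBlDl.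
near=> t.
have xt : x < t by near: t; exact: nbhs_right_gt.
have tr : t < r by near: t; exact: nbhs_right_lt.
have tr' : t < r' by near: t; exact: nbhs_right_lt.
rewrite distrC ger0_norm ?subr_ge0; last first.
  by apply: arc_length_nondecreasing; exact: ltW.
rewrite lerBlDl -lee_fin {1}/arc_length fineK; last first.
  by apply: length_fin; exact: subIsetl.
apply: ge_ereal_sup => _ [q [sq qD] <-]; rewrite lee_fin.
pose k := find (fun u => x < u) q.
have q1x : {in take k q, forall u, D u /\ u <= x}.
  move=> u; case/(nthP 0) => i; rewrite size_take_min leq_min => /andP[ik iq].
  rewrite nth_take// => <-; have [Du _] := qD _ (mem_nth 0 iq); split => //.
  by rewrite leNgt (before_find 0 ik).
have q1s : sorted <=%R (take k q) by exact: take_sorted.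
have q2s : sorted <=%R (drop k q) by exact: drop_sorted.
have q2x : {in drop k q, forall u, E u /\ u <= t}.
  move=> u uq; have [Du ut] := qD u (mem_drop uq); split => //; split => //=.
  have : has (fun u => x < u) q.
    by rewrite has_find; move: uq; rewrite -/k leqNgt; case: leqP => // kq;
      rewrite drop_oversize.
  move=> /[dup] hq /(nth_find 0); rewrite -/k => /lt_le_trans; apply.
  move: uq q2s; rewrite has_find -/k in hq; rewrite (drop_nth 0 hq) inE /=.
  by case/predU1P => [->//|uq] /(order_path_min le_trans)/allP; apply.
rewrite -(cat_take_drop k q).
have E2 : polygon_length g (drop k q) <= e / 2.
  by apply: Hr => // u /q2x[Eu ut]; split => //; exact: le_lt_trans tr.
case/lastP: (take k q) q1x q1s => [_ _|q1 a q1x q1s].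
  rewrite cat0s; apply: le_trans E2 _; rewrite [in leRHS](splitr e) addrA lerDr.
  by rewrite addr_ge0 ?(ltW e20) ?fine_ge0 ?curve_length_ge0.
case: (drop k q) q2x q2s E2 => [_ _ _|b q2 q2x q2s E2].
  rewrite cats0; apply: le_trans (_ : arc_length x <= _); last by rewrite lerDl ltW.
  by apply: polygon_le => //; exact: subIsetl.
have [Da ax] : D a /\ a <= x by apply: q1x; rewrite mem_rcons mem_head.
have [[Db xb] bt] := q2x b (mem_head _ _).
have Dx : D x by apply: (curve_dom_itv Da Db); rewrite ax ltW.
rewrite polygon_length_rcons_cat [in leRHS](splitr e) addrA lerD//.
apply: le_trans (_ : polygon_length g (rcons q1 a) + normc (g x - g a) +
    normc (g b - g x) <= _).
  by rewrite -addrA lerD2l [leRHS]addrC normc_distD.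
rewrite lerD//; last by apply: Hr' => //; rewrite xb (le_lt_trans bt).
apply: le_trans (_ : polygon_length g (rcons (rcons q1 a) x) <= _).
  by rewrite -[in leRHS]cats1 polygon_length_rcons_cat lerDl polygon_length_ge0.
apply: polygon_le; first exact: subIsetl.
  by rewrite -cats1 cat_rcons sorted_cat_cons q1s/= ax.
move=> u; rewrite mem_rcons inE => /predU1P[->|/q1x//].
by split => //=.
Unshelve. all: by end_near. Qed.
HB.instance Definition _ :=
  isCumulative.Build R _ R arc_length
    arc_length_nondecreasing arc_length_right_continuous.

(* |d tau|, pulled back to the parameter: the Stieltjes measure of the arc
   length function. Multiple points of the curve count with multiplicity. *)
Definition arc_measure := lebesgue_stieltjes_measure (arc_length : cumulative R R).

Definition arc_integral (F : R[i] -> R[i]) : R[i] :=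
  (\int[arc_measure]_(t in D) complex.Re (F (g t)))%R +i*
  (\int[arc_measure]_(t in D) complex.Im (F (g t)))%R.

(* Extended-real valued, so that no function has a norm by default. *)
Definition L2norm (F : R[i] -> R[i]) : \bar R :=
  sqrte (\int[arc_measure]_(t in D) (normc (F (g t)) ^+ 2)%:E)%E.

End arc_length.

Coercion curve_trace : rectifiable_curve >-> set.

Section complex_plane.
Context {R : realType}.
(* The topology on R[i] is the one attached to R[i]^o. *)
Implicit Types (A Omega : set R[i]).

Definition cclosure A : set R[i] := closure (A : set R[i]^o).

Definition domain Omega :=
  [/\ Omega !=set0, open (Omega : set R[i]^o) & connected (Omega : set R[i]^o)].

Definition compactly_contained A Omega :=
  compact (cclosure A : set R[i]^o) /\ cclosure A `<=` Omega.

(* [derivable] is over the scalar field R[i], i.e. complex differentiability. *)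
Definition analytic_on Omega (F : R[i] -> R[i]) :=
  forall w, Omega w -> derivable (F : R[i]^o -> R[i]^o) w 1.

End complex_plane.

(* A Hilbert space of functions on Omega with continuous point evaluations.
   Functions are total on R[i], but only their values on Omega matter: two
   elements agreeing on Omega are equal. The form [dotp] is linear in its
   first argument and conjugate-linear in the second. *)
Record rkhs (R : realType) (Omega : set R[i]) := RKHS {
  rkhs_space :> completeNormedModType R[i] ;
  dotp : {dot rkhs_space for Num.conj} ;
  norm_dotp : forall f : rkhs_space, `|f| ^+ 2 = dotp f f ;
  feval : rkhs_space -> R[i] -> R[i] ;
  feval_linear : forall w, Omega w -> scalar (fun f => feval f w) ;
  feval_inj : forall f h : rkhs_space,
    (forall w, Omega w -> feval f w = feval h w) -> f = h ;
  feval_continuous : forall w, Omega w ->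
    continuous (fun f : rkhs_space => feval f w : R[i]^o) }.

Section extremal.
Context {R : realType} {Omega : set R[i]} {H : rkhs Omega}.
Variables (p : R[i] -> H) (G : rectifiable_curve R).

Definition reproducing_kernel :=
  forall w, Omega w -> forall f : H, feval f w = dotp H f (p w).

Definition kernel (zeta tau : R[i]) : R[i] := feval (p tau) zeta.

Definition integral_operator (f : H) (zeta : R[i]) : R[i] :=
  arc_integral G (fun tau => kernel zeta tau * feval f tau).

(* K u + eps^2 u = p_z, as an equality of functions on Omega. *)
Definition solves_equation (eps : R) (z : R[i]) (u : H) :=
  forall zeta, Omega zeta ->
    integral_operator u zeta + (eps ^+ 2)%:C * feval u zeta = kernel zeta z.

(* min {1 / ||u||, eps / ||u||_G}, computed in \bar R where 1 / 0 = +oo, so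
   that a zero ||u||_G does not constrain the minimum. If u = 0 both terms are
   +oo and [fine] returns 0. *)
Definition scaling (eps : R) (u : H) : R :=
  fine (mine ((complex.Re `|u|)%:E^-1) (eps%:E / L2norm G (feval u)))%E.

End extremal.

(* Main.v *)
Require Import Defs.
From HB Require Import structures.
From mathcomp Require Import all_boot all_order all_algebra.
From mathcomp Require Import all_classical all_reals all_analysis.
From mathcomp Require Import measurable_realfun complex.
From mathcomp Require Import ring lra.

Import Order.TTheory GRing.Theory Num.Theory.
Import numFieldNormedType.Exports.

Local Open Scope classical_set_scope.
Local Open Scope ring_scope.
Local Open Scope complex_scope.

(* The equation says that u satisfies (h, p_z) = (h, u)_Gamma + eps^2 (h, u)
   for every h = p_zeta, and hence for every h in H: (., u)_Gamma is represented
   by an element of H, and an element of H is determined by its inner products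
   with the p_zeta. The form on the right-hand side is equivalent to the inner
   product, because |f(tau)| <= |f| |p_tau| and the norms |p_tau| are bounded
   for tau on Gamma by the uniform boundedness principle; so the Riesz theorem
   gives existence and uniqueness of u.
   With a = |u| and b = |u|_Gamma, taking h = u gives u(z) = b^2 + eps^2 a^2,
   and taking h = f gives |f(z)| <= eps b + eps^2 a by Cauchy-Schwarz. Comparing
   the two is the inequality 1 + x <= 3/2 (1 + x^2), where x is b / (eps a) or
   its inverse. *)

Set Implicit Arguments.
Unset Strict Implicit.

Local Notation normc := ComplexField.Normc.normc.

(** * Real semi-inner products *)

Section semi_inner_product.
Context {R : realType} {V : lmodType R} (ip : V -> V -> R).
Hypothesis ipC : forall u v, ip u v = ip v u.
Hypothesis ipDl : forall u v w, ip (u + v) w = ip u w + ip v w.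
Hypothesis ipZl : forall r u v, ip (r *: u) v = r * ip u v.
Hypothesis ip_ge0 : forall u, 0 <= ip u u.

Definition ipnorm u := Num.sqrt (ip u u).

(** Sequential completeness for a seminorm, in a form that passes between equivalent forms on the
    same space. *)
Definition ip_complete := forall x : nat -> V,
  (forall e, 0 < e -> exists N, forall m n, (N <= m)%N -> (N <= n)%N ->
    ipnorm (x m - x n) < e) ->
  exists l, forall e, 0 < e -> exists N, forall n, (N <= n)%N ->
    ipnorm (x n - l) < e.

Lemma ipDr u v w : ip u (v + w) = ip u v + ip u w.
Proof. by rewrite ipC ipDl !(ipC _ u). Qed.

Lemma ipZr r u v : ip u (r *: v) = r * ip u v.
Proof. by rewrite ipC ipZl (ipC v). Qed.

Lemma ipBr u v w : ip u (v - w) = ip u v - ip u w.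
Proof. by rewrite -scaleN1r ipDr ipZr mulN1r. Qed.

Lemma ipnorm_ge0 u : 0 <= ipnorm u.
Proof. exact: sqrtr_ge0. Qed.

Lemma sqr_ipnorm u : ipnorm u ^+ 2 = ip u u.
Proof. exact/sqr_sqrtr/ip_ge0. Qed.

Lemma sqr_ipnormDZ t u v :
  ip (u + t *: v) (u + t *: v) = ip u u + 2 * t * ip u v + t ^+ 2 * ip v v.
Proof. rewrite !(ipDl, ipDr, ipZl, ipZr) (ipC v u); ring. Qed.

Lemma ip_cauchy_schwarz u v : `|ip u v| <= ipnorm u * ipnorm v.
Proof.
have h s t : 0 <= s ^+ 2 * ip u u + 2 * s * t * ip u v + t ^+ 2 * ip v v.
  have := ip_ge0 (s *: u + t *: v).
  by rewrite sqr_ipnormDZ !ipZl !ipZr; congr (_ <= _); ring.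
suff : ip u v ^+ 2 <= ip u u * ip v v.
  by move=> /ler_wsqrtr; rewrite sqrtr_sqr sqrtrM.
have := ip_ge0 v; rewrite le_eqVlt => /predU1P[v0|v0].
  have [->|uv0] := eqVneq (ip u v) 0; first by rewrite -v0 expr0n/= mulr0.
  (* As [ip v v = 0], the quadratic form is affine in its second coefficient; this value brings it
     down to [- ip u u - 2]. *)
  have := h 1 (- (ip u u + 1) / ip u v); rewrite -v0.
  rewrite mulr0 addr0 -mulrA divfK// expr1n => ?.
  have := ip_ge0 u; lra.
(* These coefficients turn the form into [ip v v] times the discriminant. *)
have := h (ip v v) (- ip u v).
rewrite (_ : _ + _ = ip v v * (ip u u * ip v v - ip u v ^+ 2)); last by ring.
by rewrite pmulr_rge0// subr_ge0.
Qed.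

Lemma ler_ipnormD u v : ipnorm (u + v) <= ipnorm u + ipnorm v.
Proof.
rewrite -(@ler_pXn2r _ 2)// ?nnegrE ?addr_ge0 ?ipnorm_ge0// sqr_ipnorm.
have := sqr_ipnormDZ 1 u v; rewrite scale1r => ->; rewrite sqrrD !sqr_ipnorm.
have := ip_cauchy_schwarz u v; have := ler_norm (ip u v); lra.
Qed.

Lemma ipnormZ r u : ipnorm (r *: u) = `|r| * ipnorm u.
Proof.
by rewrite /ipnorm ipZl ipZr mulrA -expr2 sqrtrM ?sqr_ge0// sqrtr_sqr.
Qed.

Lemma ipnormN u : ipnorm (- u) = ipnorm u.
Proof. by rewrite -scaleN1r ipnormZ normrN1 mul1r. Qed.

(* A minimizing sequence of [|v|^2 - 2 l v] is Cauchy by the parallelogram law. *)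
Lemma ip_riesz (l : V -> R) (L : R) : ip_complete ->
  (forall u v, l (u + v) = l u + l v) -> (forall r u, l (r *: u) = r * l u) ->
  (forall u, `|l u| <= L * ipnorm u) -> exists u, forall h, l h = ip h u.
Proof.
move=> ipc lD lZ lL.
pose J v := ip v v - 2 * l v.
(* By the bound on [l], [J v + L ^+ 2] is at least the square of [ipnorm v - L]. *)
have Jlb v : - L ^+ 2 <= J v.
  have := lL v; rewrite ler_norml => /andP[_].
  by rewrite /J -sqr_ipnorm; have := sqr_ge0 (ipnorm v - L); nra.
pose E := [set J v | v in [set: V]].
have infE : has_inf E.
  by split; [exists (J 0); exists 0|exists (- L ^+ 2) => _ [v _ <-]; exact: Jlb].
have /choice[x xP] : forall n, exists v, J v < inf E + n.+1%:R^-1.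
  move=> n.
  have n0 : 0 < n.+1%:R^-1 :> R by rewrite invr_gt0.
  have [_ [v _ <-] vP] := inf_adherent n0 infE.
  by exists v.
have Jinf v : inf E <= J v by apply: ge_inf; [case: infE|exists v].
(* At the midpoint of [x m] and [x n], [J] is the mean of the two values minus a quarter of this
   square, and still at least [inf E]. *)
have xC m n : ipnorm (x m - x n) ^+ 2 <= 2 * (m.+1%:R^-1 + n.+1%:R^-1).
  have := Jinf (2^-1 *: (x m + x n)); have := xP m; have := xP n.
  rewrite /J sqr_ipnorm -scaleN1r sqr_ipnormDZ lZ lD ipZl ipZr.
  rewrite ipDl !ipDr (ipC (x n) (x m)) sqrrN expr1n.
  by move: (inf E) m.+1%:R^-1 n.+1%:R^-1 => *; lra.
have small e : 0 < e -> exists N, forall n, (N <= n)%N -> n.+1%:R^-1 < e :> R.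
  move=> e0; have [N N1] : exists N, N.+1%:R^-1 < e :> R.
    exists (Num.truncn e^-1).
    by rewrite -ltf_pV2 ?(posrE,divr_gt0)// invrK truncnS_gt.
  exists N => n Nn; apply: le_lt_trans N1.
  by rewrite lef_pV2 ?posrE// ler_nat.
have [e e0|u xu] := ipc x.
  have [|N NP] := small (e ^+ 2 / 4); first by rewrite divr_gt0 ?exprn_gt0.
  exists N => m n /NP m1 /NP n1.
  rewrite -(@ltr_pXn2r _ 2)// ?nnegrE ?ipnorm_ge0// ?ltW//.
  by have := xC m n; move: m.+1%:R^-1 n.+1%:R^-1 m1 n1 => *; lra.
exists u => h; apply/eqP; rewrite -subr_eq0; apply/eqP.
(* The added 1 keeps [q] positive when [h] has length 0. *)
pose q := ip h h + 1; have q0 : 0 < q by rewrite ltr_wpDl.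
have key n : (l h - ip h u) ^+ 2 <= 2 * q * n.+1%:R^-1 +
    2 * q * ipnorm (x n - u) ^+ 2.
  have d1 : (l h - ip h (x n)) ^+ 2 <= q * n.+1%:R^-1.
    (* Moving from [x n] by [t *: h] lowers [J] by [t ^+ 2 * q + t ^+ 2], while [J (x n)] exceeds
       [inf E] by less than [n.+1%:R^-1]. *)
    have [t tE] : exists t, l h = ip h (x n) + t * q.
      by exists ((l h - ip h (x n)) / q); rewrite divfK ?gt_eqF//; ring.
    have := Jinf (x n + t *: h); have := xP n.
    rewrite /J sqr_ipnormDZ lD lZ (ipC _ h) tE.
    rewrite [ip h (x n) + _ - _]addrAC subrr add0r.
    move: (inf E) n.+1%:R^-1 => m d J1 J2.
    have : t ^+ 2 * q <= d by have := sqr_ge0 t; rewrite /q in J2 *; lra.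
    by rewrite -(ler_pM2l q0); congr (_ <= _); ring.
  have d2 : ip h (x n - u) ^+ 2 <= q * ipnorm (x n - u) ^+ 2.
    rewrite -[leLHS]real_normK ?num_real//.
    apply: le_trans (_ : (ipnorm h * ipnorm (x n - u)) ^+ 2 <= _).
      by rewrite ler_pXn2r// ?nnegrE ?mulr_ge0 ?ipnorm_ge0 ?ip_cauchy_schwarz.
    by rewrite exprMn (sqr_ipnorm h) ler_wpM2r ?sqr_ge0 // lerDl.
  (* This is [(a + b)^2 <= 2 a^2 + 2 b^2] for the two errors bounded in [d1] and [d2]. *)
  have := sqr_ge0 (l h - ip h (x n) - ip h (x n - u)).
  move: n.+1%:R^-1 d1 d2 => d; rewrite ipBr; lra.
apply/eqP; rewrite -sqrf_eq0 eq_le sqr_ge0 andbT.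
apply/ler_addgt0Pl => e e0; rewrite addr0.
have e1 : 0 < e / (4 * q) by rewrite divr_gt0// mulr_gt0.
have [N1 N1P] := small _ e1.
have [|N2 N2P] := xu (Num.sqrt (e / (4 * q))); first by rewrite sqrtr_gt0.
pose N := maxn N1 N2; apply: le_trans (key N) _.
have := N1P N (leq_maxl _ _).
have : ipnorm (x N - u) ^+ 2 < e / (4 * q).
  rewrite -[ltRHS]sqr_sqrtr ?ltW// ltr_pXn2r// ?nnegrE ?ipnorm_ge0//.
  exact/N2P/leq_maxr.
rewrite !ltr_pdivlMr ?mulr_gt0//; move: N.+1%:R^-1 => *; lra.
Qed.

(* Uniform boundedness by a gliding hump: [x n.+1] adds to [x n] a vector of
   length [3 ^- n] along [p (i n)], signed so that the two contributions to
   [ip (x n.+1) (p (i n))] do not cancel. *)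
Lemma ip_uniform_bound (I : Type) (D : set I) (p : I -> V) : ip_complete ->
  (forall v, exists M, forall i, D i -> `|ip v (p i)| <= M) ->
  exists M, forall i, D i -> ipnorm (p i) <= M.
Proof.
move=> ipc pb; apply: contrapT => /forallNP nb.
(* The threshold makes half of the contribution [3 ^- n * ipnorm (p (i n))] exceed [n + 1]. *)
have /choice[i iP] : forall n, exists j,
    D j /\ 2 * n.+1%:R * 3 ^+ n < ipnorm (p j).
  move=> n; have := nb (2 * n.+1%:R * 3 ^+ n).
  move=> /existsNP[j /not_implyP[Dj /negP]]; rewrite -ltNge => jP.
  by exists j.
pose P n := p (i n).
have P0 n : 0 < ipnorm (P n).
  by apply: le_lt_trans (iP n).2; rewrite !mulr_ge0// exprn_ge0.
pose step n v := v + ((if 0 <= ip v (P n) then 1 else -1) *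
  (3 ^- n / ipnorm (P n))) *: P n.
pose x := fix x n := if n is n'.+1 then step n' (x n') else 0.
have t0 n : 0 < 3 ^- n :> R by rewrite invr_gt0 exprn_gt0.
have xS n : ipnorm (x n.+1 - x n) <= 3 ^- n.
  rewrite /= /step addrAC subrr add0r ipnormZ normrM.
  rewrite [X in _ * X * _]ger0_norm; last first.
    by rewrite divr_ge0 ?ltW.
  rewrite -mulrA divfK ?gt_eqF//; case: ifP => _.
  + by rewrite normr1 mul1r.
  + by rewrite normrN1 mul1r.
have xP n : 3 ^- n * ipnorm (P n) <= `|ip (x n.+1) (P n)|.
  rewrite /= /step ipDl ipZl -sqr_ipnorm.
  rewrite (_ : _ * _ * _ = (if 0 <= ip (x n) (P n) then 1 else -1) *
     (3 ^- n * ipnorm (P n))); last first.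
    by field; rewrite gt_eqF /= ?P0 ?gt_eqF ?P0 ?exprn_gt0.
  have : 0 < 3 ^- n * ipnorm (P n) by rewrite mulr_gt0.
  move: (3 ^- n * _) => c c0.
  case: ifPn => [a0|]; first by rewrite ger0_norm; lra.
  by rewrite -ltNge => a0; rewrite ltr0_norm; lra.
(* The right-hand side is the geometric sum of the step lengths [3 ^- j] for j from n to n + k -
   1. *)
have xD n k : ipnorm (x (n + k)%N - x n) <= 3 / 2 * (3 ^- n - 3 ^- (n + k)).
  elim: k => [|k ih].
    by rewrite addn0 !subrr mulr0 -(scale0r 0) ipnormZ normr0 mul0r.
  rewrite -(subrKA (x (n + k)%N)) addnS.
  apply: le_trans (ler_ipnormD _ _) _; apply: le_trans (lerD (xS _) ih) _.
  by rewrite exprS invfM; lra.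
have small (e : R) : 0 < e -> exists N, 3 ^- N < e.
  move=> e0; exists (Num.truncn e^-1); rewrite -ltf_pV2 ?posrE// invrK.
  apply: lt_le_trans (truncnS_gt _) _.
  by rewrite -natrX ler_nat ltn_expl.
have [e e0|l xl] := ipc x.
  have [|N Ne] := small (e / 3); first by rewrite divr_gt0.
  exists N.
  have xN n : (N <= n)%N -> ipnorm (x n - x N) <= 3 / 2 * 3 ^- N.
    move=> /subnKC <-; apply: le_trans (xD _ _) _.
    by rewrite ler_pM2l// gerDl oppr_le0 ltW.
  move=> m n /xN xm /xN xn; rewrite -(subrKA (x N)).
  apply: le_lt_trans (ler_ipnormD _ _) _.
  rewrite -[in X in _ + X]opprB ipnormN; lra.
have lx n : ipnorm (l - x n) <= 3 / 2 * 3 ^- n.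
  apply/ler_addgt0Pr => e e0; have [N /(_ (n + N)%N (leq_addl _ _)) NP] := xl _ e0.
  rewrite -(subrKA (x (n + N)%N)); apply: le_trans (ler_ipnormD _ _) _.
  rewrite addrC lerD//; last by rewrite -ipnormN opprB ltW.
  by apply: le_trans (xD _ _) _; rewrite ler_pM2l// gerDl oppr_le0 ltW.
(* All steps after [x n.+1] have total length at most half of [3 ^- n], so they cancel at most half
   of the contribution along [P n]. What is left is at least [n + 1 > M]. *)
have [M MP] := pb l; pose n := Num.truncn M.
have := MP _ (iP n).1; apply/negP; rewrite -ltNge.
apply: lt_le_trans (truncnS_gt _) _; rewrite -/n -/(P n).
have := ip_cauchy_schwarz (l - x n.+1) (P n).
have /ltW := (iP n).2; rewrite -/(P n).
rewrite (_ : 2 * _ * _ = n.+1%:R * (2 * 3 ^+ n)); last by ring.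
rewrite -ler_pdivlMr; last by rewrite mulr_gt0// exprn_gt0.
rewrite invfM => nP.
have := lx n.+1; rewrite -(ler_pM2r (P0 n)) => lP lP'.
have := le_trans lP' lP; have := xP n.
have -> : ip l (P n) = ip (l - x n.+1) (P n) + ip (x n.+1) (P n).
  by rewrite -ipDl subrK.
rewrite exprS invfM => ? ?.
have := ler_normD (ip (l - x n.+1) (P n) + ip (x n.+1) (P n))
  (- ip (l - x n.+1) (P n)).
rewrite normrN [_ + _ - _]addrAC subrr add0r; lra.
Qed.

End semi_inner_product.

(** Carries the completeness of H over to the form on the right-hand side of the equation, to which
    the Riesz theorem is applied. *)
Lemma ip_complete_equiv (R : realType) (V : lmodType R) (ip ip' : V -> V -> R)
    (c C : R) : 0 < c -> (forall v, c * ipnorm ip v <= ipnorm ip' v) ->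
  (forall v, ipnorm ip' v <= C * ipnorm ip v) ->
  ip_complete ip -> ip_complete ip'.
Proof.
move=> c0 cip Cip ipc x xC.
have [e e0|l xl] := ipc x.
  have [N NP] := xC (c * e) (mulr_gt0 c0 e0); exists N => m n mN nN.
  by rewrite -(ltr_pM2l c0); apply: le_lt_trans (cip _) _; exact: NP.
(* A positive substitute for [C], fit to divide by. *)
have C0 : 0 < `|C| + 1 by rewrite ltr_wpDl.
exists l => e e0; have [N NP] := xl (e / (`|C| + 1)) (divr_gt0 e0 C0).
exists N => n /NP; rewrite ltr_pdivlMr// mulrC; apply: le_lt_trans.
apply: le_trans (Cip _) _; rewrite ler_wpM2r ?ipnorm_ge0//.
by rewrite (le_trans (ler_norm _))// lerDl.
Qed.

(** * Integration along a rectifiable curve *)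

Section complex_facts.
Context {R : realType}.
Implicit Types z w : R[i].

Lemma normr_normc z : `|z| = (normc z)%:C.
Proof. by case: z => a b; rewrite normc_def. Qed.

Lemma Re_mulc z w : complex.Re (z * w) =
  complex.Re z * complex.Re w - complex.Im z * complex.Im w.
Proof. by case: z w => ? ? []. Qed.

Lemma Im_mulc z w : complex.Im (z * w) =
  complex.Re z * complex.Im w + complex.Im z * complex.Re w.
Proof. by case: z w => ? ? []. Qed.

Lemma Re_conjc z : complex.Re z^*%C = complex.Re z.
Proof. by case: z. Qed.

Lemma Im_conjc z : complex.Im z^*%C = - complex.Im z.
Proof. by case: z. Qed.

Lemma conjcD z w : (z + w)^*%C = z^*%C + w^*%C.
Proof. exact: rmorphD. Qed.

Lemma conjcM z w : (z * w)^*%C = z^*%C * w^*%C.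
Proof. exact: rmorphM. Qed.

Lemma normc_conjc z : normc z^*%C = normc z.
Proof. by case: z => a b /=; rewrite sqrrN. Qed.

Lemma ler_norm_Re z : `|complex.Re z| <= normc z.
Proof. by rewrite -lecR -normr_normc normc_ge_Re. Qed.

Lemma ler_norm_Im z : `|complex.Im z| <= normc z.
Proof.
case: z => a b /=; rewrite -[leLHS]sqrtr_sqr ler_sqrt ?addr_ge0 ?sqr_ge0//.
by rewrite lerDr sqr_ge0.
Qed.

Lemma Re_continuous : continuous (@complex.Re R : R[i]^o -> R).
Proof.
move=> z; apply/(@cvgrPdist_lt _ R^o _ _ (nbhs_filter (z : R[i]^o))) => e e0.
have /(@cvgrPdist_lt _ R[i]^o _ _ (nbhs_filter (z : R[i]^o)))/(_ e%:C) :=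
  @cvg_id _ (nbhs (z : R[i]^o)).
rewrite ltcR => /(_ e0); apply: filterS => w /=; rewrite normr_normc ltcR.
by apply: le_lt_trans; rewrite -raddfB ler_norm_Re.
Qed.

Lemma Im_continuous : continuous (@complex.Im R : R[i]^o -> R).
Proof.
move=> z; apply/(@cvgrPdist_lt _ R^o _ _ (nbhs_filter (z : R[i]^o))) => e e0.
have /(@cvgrPdist_lt _ R[i]^o _ _ (nbhs_filter (z : R[i]^o)))/(_ e%:C) :=
  @cvg_id _ (nbhs (z : R[i]^o)).
rewrite ltcR => /(_ e0); apply: filterS => w /=; rewrite normr_normc ltcR.
by apply: le_lt_trans; rewrite -raddfB ler_norm_Im.
Qed.

Lemma Re_mulcJ z : complex.Re (z * z^*%C) = normc z ^+ 2.
Proof.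
case: z => a b /=; rewrite sqr_sqrtr ?addr_ge0 ?sqr_ge0//; ring.
Qed.

End complex_facts.

Section curve.
Context {R : realType} (G : rectifiable_curve R).
Local Notation D := (curve_dom G).
Local Notation g := (curve_fun G).
Local Notation mu := (arc_measure G).

Let mD : measurable D.
Proof. exact: (is_interval_measurable (@curve_dom_itv _ G)). Qed.

Lemma arc_length_le t : arc_length G t <= fine (curve_length g D).
Proof.
have fin E : E `<=` D -> curve_length g E \is a fin_num.
  move=> ED; rewrite ge0_fin_numE ?curve_length_ge0//.
  exact: le_lt_trans (le_curve_length _ ED) (curve_length_lty G).
apply: fine_le; rewrite ?fin//.
by apply: le_curve_length; exact: subIsetl.
Qed.

(** The measure of a half-open interval is an increment of the arc length, hence at most the total
    length; the intervals []-n, n]] exhaust the line, and the measure is continuous from below. *)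
Lemma arc_measure_lty : (mu D < +oo)%E.
Proof.
pose L := fine (curve_length g D).
pose I n : set R := `]- (n%:R), n%:R]%classic.
have IL n : (mu (I n) <= L%:E)%E.
  rewrite /arc_measure /lebesgue_stieltjes_measure.
  rewrite /measure_extension measurable_mu_extE/=; last exact: is_ocitv.
  rewrite wlength_itv_bnd// ?ge0_cp//.
  rewrite lee_fin lerBlDr.
  rewrite (le_trans (arc_length_le _))// lerDl fine_ge0//.
  exact: curve_length_ge0.
have : mu \o I @ \oo --> mu (\bigcup_n I n).
  apply: nondecreasing_cvg_mu; rewrite /I//; first exact: bigcup_measurable.
  by move=> *; apply/subsetPset/subset_itv; rewrite leBSide/= ?lerN2 ler_nat.
rewrite (bigcup_itvT false false) => muT.
apply: le_lt_trans (ltry L).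
apply: le_trans (_ : mu setT <= _)%E; first by rewrite le_measure ?inE.
rewrite -(cvg_lim _ muT)//; apply: lime_le.
  by apply/cvg_ex; eexists; exact: muT.
by apply: nearW => n /=; exact: IL.
Qed.

(** A class stable under sums and products and, [mu D] being finite, made of integrable functions;
    this settles every integrability condition below. *)
Definition bounded_measurable (f : R -> R) :=
  measurable_fun D f /\ exists M, forall t, D t -> `|f t| <= M.

Lemma bounded_measurableD f h : bounded_measurable f -> bounded_measurable h ->
  bounded_measurable (fun t => f t + h t).
Proof.
move=> [mf [M fM]] [mh [N hN]]; split; first exact: measurable_funD.
exists (M + N) => t Dt; apply: le_trans (ler_normD _ _) _.
by rewrite lerD ?fM ?hN.
Qed.

Lemma bounded_measurableM f h : bounded_measurable f -> bounded_measurable h ->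
  bounded_measurable (fun t => f t * h t).
Proof.
move=> [mf [M fM]] [mh [N hN]]; split; first exact: measurable_funM.
by exists (M * N) => t Dt; rewrite normrM ler_pM ?fM ?hN.
Qed.

Lemma bounded_measurable_cst r : bounded_measurable (cst r).
Proof. by split; [exact: measurable_cst|exists `|r|]. Qed.

Lemma bounded_measurableZ r f : bounded_measurable f ->
  bounded_measurable (fun t => r * f t).
Proof. exact/bounded_measurableM/bounded_measurable_cst. Qed.

Lemma bounded_measurableN f : bounded_measurable f ->
  bounded_measurable (fun t => - f t).
Proof.
by move=> /(bounded_measurableZ (-1)); under eq_fun do rewrite mulN1r.
Qed.

Lemma bounded_measurable_integrable f : bounded_measurable f ->
  mu.-integrable D (EFin \o f).
Proof.
move=> [mf [M fM]]; apply: measurable_bounded_integrable => //.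
  exact: arc_measure_lty.
exists M; split; first exact: num_real.
by move=> N /ltW MN t /= /fM /le_trans; apply.
Qed.

Definition curve_bounded (F : R[i] -> R[i]) :=
  bounded_measurable (fun t => complex.Re (F (g t))) /\
  bounded_measurable (fun t => complex.Im (F (g t))).

Lemma curve_boundedM F1 F2 : curve_bounded F1 -> curve_bounded F2 ->
  curve_bounded (fun w => F1 w * F2 w).
Proof.
move=> [? ?] [? ?]; split.
  under eq_fun do rewrite Re_mulc.
  by apply: bounded_measurableD; [|apply: bounded_measurableN];
    exact: bounded_measurableM.
under eq_fun do rewrite Im_mulc.
by apply: bounded_measurableD; exact: bounded_measurableM.
Qed.

Lemma curve_boundedJ F : curve_bounded F -> curve_bounded (fun w => (F w)^*%C).
Proof.
move=> [? ?]; split; first by under eq_fun do rewrite Re_conjc.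
by under eq_fun do rewrite Im_conjc; exact: bounded_measurableN.
Qed.

Lemma eq_arc_integral F1 F2 : (forall t, D t -> F1 (g t) = F2 (g t)) ->
  arc_integral G F1 = arc_integral G F2.
Proof.
by move=> F12; rewrite /arc_integral; congr (_ +i* _);
  apply: eq_Rintegral => t /[!inE] /F12 ->.
Qed.

Lemma arc_integralD F1 F2 : curve_bounded F1 -> curve_bounded F2 ->
  arc_integral G (fun w => F1 w + F2 w) = arc_integral G F1 + arc_integral G F2.
Proof.
move=> [? ?] [? ?]; rewrite /arc_integral; congr (_ +i* _).
  by under eq_Rintegral do rewrite raddfD;
    rewrite RintegralD//; exact: bounded_measurable_integrable.
by under eq_Rintegral do rewrite raddfD;
  rewrite RintegralD//; exact: bounded_measurable_integrable.
Qed.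

Lemma arc_integralZ c F : curve_bounded F ->
  arc_integral G (fun w => c * F w) = c * arc_integral G F.
Proof.
move=> [? ?]; rewrite /arc_integral; case: c => a b; congr (_ +i* _).
  under eq_Rintegral do rewrite Re_mulc/=.
  rewrite RintegralB// ?RintegralZl//; apply: bounded_measurable_integrable => //;
    exact: bounded_measurableZ.
under eq_Rintegral do rewrite Im_mulc/=.
rewrite RintegralD// ?RintegralZl//; apply: bounded_measurable_integrable => //;
    exact: bounded_measurableZ.
Qed.

Lemma arc_integralJ F : curve_bounded F ->
  arc_integral G (fun w => (F w)^*%C) = (arc_integral G F)^*%C.
Proof.
move=> [? ?]; rewrite /arc_integral /=; congr (_ +i* _).
  by apply: eq_Rintegral => t _; rewrite Re_conjc.
under eq_Rintegral do rewrite Im_conjc -mulN1r.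
by rewrite RintegralZl ?mulN1r//; exact: bounded_measurable_integrable.
Qed.

Lemma Re_arc_integral_ge0 F : (forall w, 0 <= complex.Re (F w)) ->
  0 <= complex.Re (arc_integral G F).
Proof. by move=> F0; apply: Rintegral_ge0. Qed.

Lemma Re_arc_integral_le F M : curve_bounded F ->
  (forall t, D t -> complex.Re (F (g t)) <= M) ->
  complex.Re (arc_integral G F) <= M * fine (mu D).
Proof.
move=> [? ?] FM; rewrite /= -Rintegral_cst//; apply: le_Rintegral => //.
  exact: bounded_measurable_integrable.
exact/bounded_measurable_integrable/bounded_measurable_cst.
Qed.

(** E F : curve_bounded F -> For such [F] the extended-real norm is finite and comes from a
    Hermitian form. *)
Lemma L2normE F : curve_bounded F ->
  L2norm G F = (Num.sqrt (complex.Re (arc_integral G (fun w => F w * (F w)^*%C))))%:E.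
Proof.
move=> bF; have [bRe _] := curve_boundedM bF (curve_boundedJ bF).
rewrite /L2norm /= /Rintegral.
rewrite [X in sqrte X](_ : _ =
  \int[mu]_(t in D) (complex.Re (F (g t) * (F (g t))^*%C))%:E)%E; last first.
  by apply: eq_integral => t _; rewrite Re_mulcJ.
rewrite -[X in sqrte X]fineK//.
by apply: integrable_fin_num; [exact: mD|exact: bounded_measurable_integrable].
Qed.

(** Measurability comes from continuity of the curve on its interval of parameters, boundedness from
    compactness of the closure of the trace. *)
Lemma continuous_curve_bounded F : compact (cclosure G : set R[i]^o) ->
  (forall w, cclosure G w -> {for w, continuous (F : R[i]^o -> R[i]^o)}) ->
  curve_bounded F.
Proof.
move=> cG cF.
have gG t : D t -> cclosure G (g t).
  by move=> Dt; apply: subset_closure; exists t.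
have aux (h : R[i]^o -> R) : continuous h ->
    bounded_measurable (fun t => h (F (g t))).
  move=> ch; split.
    apply: subspace_continuous_measurable_fun => //.
    apply/subspace_continuousP => t Dt.
    have /subspace_continuousP/(_ t Dt) gt := @curve_continuous _ G.
    apply: (cvg_comp (curve_fun G) (h \o F) gt).
    apply: (@continuous_comp _ _ _ (F : R[i]^o -> R[i]^o)); first exact/cF/gG.
    exact: ch.
  have : compact ((h \o F) @` cclosure G).
    apply: (@continuous_compact R[i]^o R) => //.
    apply: continuous_in_subspaceT => w; rewrite inE => Gw.
    by apply: (@continuous_comp _ _ _ (F : R[i]^o -> R[i]^o));
      [exact: cF|exact: ch].
  move=> /compact_bounded[M [_ /(_ (M + 1))]]; rewrite ltrDl => /(_ ltr01) MP.
  exists (M + 1) => t Dt; apply: MP => /=; exists (g t) => //; exact: gG.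
by split; apply: aux; [exact: Re_continuous|exact: Im_continuous].
Qed.

End curve.

(** * Hermitian forms *)

(* Restriction of scalars, so that the real part of a Hermitian form is a real
   inner product. *)
Definition realified (R : realType) (V : lmodType R[i]) : Type := V.

Section realified.
Context {R : realType} (V : lmodType R[i]).

HB.instance Definition _ := GRing.Zmodule.copy (realified V) V.

Definition realified_scale (r : R) (v : realified V) : realified V :=
  r%:C *: (v : V).

Let scaleA a b v : realified_scale a (realified_scale b v) =
  realified_scale (a * b) v.
Proof. by rewrite /realified_scale scalerA rmorphM. Qed.

Let scale1 : left_id 1 realified_scale.
Proof. by move=> v; rewrite /realified_scale scale1r. Qed.

Let scaleDr : right_distributive realified_scale +%R.
Proof. by move=> a u v; exact: scalerDr. Qed.

Let scaleDl v : {morph realified_scale^~ v : a b / a + b}.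
Proof. by move=> a b; rewrite /realified_scale rmorphD; exact: scalerDl. Qed.

HB.instance Definition _ := GRing.Zmodule_isLmodule.Build R (realified V)
  scaleA scale1 scaleDr scaleDl.

End realified.

Section hermitian_form.
Context {R : realType} {V : lmodType R[i]} (A : V -> V -> R[i]).

Definition re_form (u v : realified V) : R := complex.Re (A u v).

Hypothesis AC : forall u v, A u v = (A v u)^*%C.
Hypothesis ADl : forall u v w, A (u + v) w = A u w + A v w.
Hypothesis AZl : forall c u v, A (c *: u) v = c * A u v.
Hypothesis A_ge0 : forall u, 0 <= complex.Re (A u u).

Lemma re_formC u v : re_form u v = re_form v u.
Proof. by rewrite /re_form AC Re_conjc. Qed.

Lemma re_formDl u v w : re_form (u + v) w = re_form u w + re_form v w.
Proof. by rewrite /re_form -raddfD -ADl. Qed.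

Lemma re_formZl r u v : re_form (r *: u) v = r * re_form u v.
Proof. by rewrite /re_form AZl Re_mulc/= mul0r subr0. Qed.

Lemma re_form_ge0 u : 0 <= re_form u u.
Proof. exact: A_ge0. Qed.

(** By symmetry [A u u] is its own conjugate, hence real. *)
Lemma form_diagE u : A u u = (ipnorm re_form u ^+ 2)%:C.
Proof.
rewrite (sqr_ipnorm re_form_ge0) /re_form.
have := AC u u; case: (A u u) => a b [/eqP]; rewrite -addr_eq0.
by rewrite -mulr2n mulrn_eq0 /= => /eqP ->.
Qed.

Lemma ipnorm_re_formZ (c : R[i]) (u : V) :
  ipnorm re_form (c *: u : V) = normc c * ipnorm re_form u.
Proof.
rewrite -[RHS]ger0_norm ?mulr_ge0 ?normc_ge0 ?ipnorm_ge0// -sqrtr_sqr.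
congr Num.sqrt; rewrite exprMn /re_form AZl AC AZl form_diagE.
by rewrite -Re_mulcJ; case: c => a b /=; ring.
Qed.

Lemma form_cauchy_schwarz u v : normc (A u v) <=
  ipnorm re_form u * ipnorm re_form v.
Proof.
have [z0|z0] := eqVneq (normc (A u v)) 0.
  by rewrite z0 mulr_ge0 ?ipnorm_ge0.
have z1 : 0 < normc (A u v) by rewrite lt_def z0 normc_ge0.
(* Multiplying [u] by the conjugate of [A u v] makes the form value real, equal to
   [normc (A u v) ^+ 2]; one factor then cancels. *)
have := ip_cauchy_schwarz re_formC re_formDl re_formZl re_form_ge0
  ((A u v)^*%C *: u : V) v.
rewrite {1}/re_form AZl mulrC Re_mulcJ ger0_norm ?sqr_ge0// ipnorm_re_formZ.
by rewrite normc_conjc -mulrA ler_pM2l.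
Qed.

Lemma form_riesz (l : V -> R[i]) (L : R) : ip_complete re_form ->
  (forall u v, l (u + v) = l u + l v) -> (forall c u, l (c *: u) = c * l u) ->
  (forall u, normc (l u) <= L * ipnorm re_form u) ->
  exists u, forall h, l h = A h u.
Proof.
move=> Ac lD lZ lL.
have [||u|u uP] := ip_riesz re_formC re_formDl re_formZl re_form_ge0
  (l := fun v : realified V => complex.Re (l v)) (L := L) Ac.
- by move=> u v; rewrite -raddfD -lD.
- by move=> r u; rewrite lZ Re_mulc/= mul0r subr0.
- exact: le_trans (ler_norm_Re _) (lL u).
(* The vector representing the real part of [l] also represents the imaginary part, which is read
   off from the real part at ['i *: h]. *)
exists u => h; have := uP h; have := uP ('i *: h : V).
rewrite /re_form lZ AZl; case: (l h) (A h u) => a b [c d] /=; simpc.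
by move=> /oppr_inj -> ->.
Qed.

End hermitian_form.

(** * Reproducing kernel Hilbert spaces *)

Section rkhs_inner_product.
Context {R : realType} {Omega : set R[i]} (H : rkhs Omega).

Lemma dotpC (f h : H) : dotp H f h = (dotp H h f)^*%C.
Proof. by rewrite (hermC (dotp H)) expr0 mul1r. Qed.

Lemma dotpDl (f h k : H) : dotp H (f + h) k = dotp H f k + dotp H h k.
Proof. exact: linearDl. Qed.

Lemma dotpZl c (f h : H) : dotp H (c *: f) h = c * dotp H f h.
Proof. exact: linearZl_LR. Qed.

Lemma dotp_ge0 (f : H) : 0 <= complex.Re (dotp H f f).
Proof.
rewrite -norm_dotp; have : 0 <= `|f| ^+ 2 by rewrite exprn_ge0.
by rewrite lecE => /andP[].
Qed.

Lemma norm_rkhsE (f : H) : `|f| = (ipnorm (re_form (dotp H)) f)%:C.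
Proof.
apply/eqP; rewrite -(@eqrXn2 _ 2)// ?ler0c ?ipnorm_ge0// norm_dotp.
by rewrite (form_diagE dotpC dotp_ge0) rmorphXn.
Qed.

Lemma rkhs_complete : ip_complete (re_form (dotp H)).
Proof.
move=> x xC; have : cvg (x @ \oo : set_system H).
  apply: cauchy_cvg; apply: cauchy_exP => e; rewrite ltcE => /andP[/eqP/= e1 e0].
  (* The norm of [H] takes values in [R[i]], where a positive number is a real one. *)
  have {e1}-> : e = (complex.Re e)%:C by move: e1; case: e {e0} => a b /= ->.
  have [N NP] := xC _ e0; exists (x N); exists N => // n /= Nn.
  rewrite -ball_normE /= norm_rkhsE ltcR; exact: NP.
move=> /cvg_ex[l xl]; exists l => e e0.
have e1 : 0 < e%:C by rewrite ltcR.
have /cvgrPdist_lt/(_ _ e1)[N _ NP] := xl; exists N => n Nn.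
by rewrite -ltcR -norm_rkhsE distrC; exact: NP.
Qed.

Lemma fevalD w (f h : H) : Omega w -> feval (f + h) w = feval f w + feval h w.
Proof. by move=> Ow; have := feval_linear Ow 1 f h; rewrite scale1r mul1r. Qed.

Lemma fevalZ w c (f : H) : Omega w -> feval (c *: f) w = c * feval f w.
Proof.
move=> Ow; have f0 : feval (0 : H) w = 0.
  by apply: (@addrI _ (feval (0 : H) w)); rewrite -fevalD// !addr0.
by have := feval_linear Ow c f 0; rewrite f0 !addr0.
Qed.

End rkhs_inner_product.

(** * The inner product of L^2(Gamma) as a bounded form on H *)

Section gram.
Context {R : realType} {Omega : set R[i]} (H : rkhs Omega).
Variable G : rectifiable_curve R.
Local Notation D := (curve_dom G).
Local Notation g := (curve_fun G).
Hypothesis G_Omega : forall t, D t -> Omega (g t).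
Hypothesis H_bounded : forall f : H, curve_bounded G (feval f).

Definition gram (f h : H) : R[i] :=
  arc_integral G (fun w => feval f w * (feval h w)^*%C).

Let prod_bounded (f h : H) : curve_bounded G (fun w => feval f w * (feval h w)^*%C).
Proof. exact/curve_boundedM/curve_boundedJ. Qed.

Lemma gramC f h : gram f h = (gram h f)^*%C.
Proof.
rewrite /gram -arc_integralJ; [|exact: prod_bounded..].
apply: eq_arc_integral => t Dt.
by rewrite conjcM conjcK mulrC.
Qed.

Lemma gramDl f h k : gram (f + h) k = gram f k + gram h k.
Proof.
rewrite /gram -arc_integralD; [|exact: prod_bounded..].
apply: eq_arc_integral => t Dt.
by rewrite fevalD ?mulrDl//; exact: G_Omega.
Qed.

Lemma gramZl c f h : gram (c *: f) h = c * gram f h.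
Proof.
rewrite /gram -arc_integralZ; [|exact: prod_bounded..].
apply: eq_arc_integral => t Dt.
by rewrite fevalZ ?mulrA//; exact: G_Omega.
Qed.

Lemma gram_ge0 f : 0 <= complex.Re (gram f f).
Proof. by apply: Re_arc_integral_ge0 => w; rewrite Re_mulcJ sqr_ge0. Qed.

Lemma L2norm_gram f : L2norm G (feval f) = (ipnorm (re_form gram) f)%:E.
Proof. exact: L2normE. Qed.

Variable p : R[i] -> H.
Hypothesis p_kernel : reproducing_kernel p.

(** Uniform boundedness: for each fixed f the products (f, p_tau) = f(tau) are bounded for tau on
    the curve. *)
Lemma kernel_bounded : exists S, forall t, D t ->
  ipnorm (re_form (dotp H)) (p (g t)) <= S.
Proof.
apply: (ip_uniform_bound (re_formC (@dotpC _ _ H)) (re_formDl (@dotpDl _ _ H))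
  (re_formZl (@dotpZl _ _ H)) (re_form_ge0 (@dotp_ge0 _ _ H)) (p := p \o g)).
  exact: rkhs_complete.
move=> f; have [[_ [M fM]] _] := H_bounded f; exists M => t Dt.
by rewrite /re_form /= -p_kernel; [exact: fM|exact: G_Omega].
Qed.

(** Integrate [|f(tau)| <= |p_tau| |f|]: the constant is the bound on the kernel times the square
    root of the mass of the curve. *)
Lemma gram_bounded : exists K, forall f,
  ipnorm (re_form gram) f <= K * ipnorm (re_form (dotp H)) f.
Proof.
have [S0 S0P] := kernel_bounded; pose S := `|S0|.
have S_ge0 : 0 <= S by exact: normr_ge0.
have SP t : D t -> ipnorm (re_form (dotp H)) (p (g t)) <= S.
  by move=> Dt; apply: le_trans (S0P t Dt) (ler_norm _).
set m := fine (arc_measure G D); exists (S * Num.sqrt m) => f.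
have m0 : 0 <= m by exact: fine_ge0.
rewrite -(@ler_pXn2r _ 2)// ?nnegrE ?mulr_ge0 ?ipnorm_ge0 ?sqrtr_ge0//.
rewrite (sqr_ipnorm (re_form_ge0 gram_ge0)) mulrAC exprMn sqr_sqrtr//.
apply: Re_arc_integral_le => // t Dt.
rewrite Re_mulcJ ler_pXn2r ?nnegrE ?normc_ge0 ?mulr_ge0 ?ipnorm_ge0//.
rewrite p_kernel; last exact: G_Omega.
apply: le_trans (form_cauchy_schwarz (@dotpC _ _ H) (@dotpDl _ _ H)
  (@dotpZl _ _ H) (@dotp_ge0 _ _ H) _ _) _.
by rewrite mulrC ler_wpM2r ?ipnorm_ge0 ?SP.
Qed.

(* [k] is K w, as (h, K w) = (h, w)_Gamma. *)
Lemma gram_riesz w : exists k, forall h, gram h w = dotp H h k.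
Proof.
have [K KP] := gram_bounded.
apply: (form_riesz (@dotpC _ _ H) (@dotpDl _ _ H) (@dotpZl _ _ H)
  (@dotp_ge0 _ _ H) (l := gram^~ w) (L := K * ipnorm (re_form gram) w)).
- exact: rkhs_complete.
- by move=> u v; exact: gramDl.
- by move=> c u; exact: gramZl.
move=> u; apply: le_trans (form_cauchy_schwarz gramC gramDl gramZl gram_ge0 _ _) _.
by rewrite mulrAC ler_wpM2r ?ipnorm_ge0.
Qed.

(** * Existence and uniqueness for the equation *)

Variables (eps : R) (z : R[i]).
Hypothesis eps_gt0 : 0 < eps.

(** The equation paired with every h, with [gram h u] in place of (h, K u). *)
Definition weak_solution (u : H) := forall h,
  dotp H h (p z) = gram h u + (eps ^+ 2)%:C * dotp H h u.

(** Riesz representation of (., p_z) with respect to the form [A]. The term with [eps] bounds [A]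
    from below, [gram_bounded] bounds it from above, so [A] inherits completeness. *)
Lemma weak_solution_exists : exists u, weak_solution u.
Proof.
pose A (f h : H) := gram f h + (eps ^+ 2)%:C * dotp H f h.
have AC f h : A f h = (A h f)^*%C.
  rewrite /A gramC dotpC conjcD conjcM; congr (_ + _ * _).
  by rewrite [RHS]conjc_real.
have ADl f h k : A (f + h) k = A f k + A h k.
  by rewrite /A gramDl dotpDl; ring.
have AZl c f h : A (c *: f) h = c * A f h.
  by rewrite /A gramZl dotpZl; ring.
have AE f : re_form A f f = ipnorm (re_form gram) f ^+ 2 +
    (eps * ipnorm (re_form (dotp H)) f) ^+ 2.
  rewrite /re_form /A raddfD/= (Re_mulc _%:C)/= mul0r subr0 exprMn.
  by rewrite (sqr_ipnorm (re_form_ge0 gram_ge0))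
    (sqr_ipnorm (re_form_ge0 (@dotp_ge0 _ _ H))).
have A_ge0 f : 0 <= complex.Re (A f f).
  by rewrite [leRHS]AE addr_ge0// sqr_ge0.
have lo f : eps * ipnorm (re_form (dotp H)) f <= ipnorm (re_form A) f.
  rewrite -(@ler_pXn2r _ 2)// ?nnegrE ?ipnorm_ge0// ?mulr_ge0 ?ipnorm_ge0//
    ?(ltW eps_gt0)//.
  by rewrite (sqr_ipnorm (re_form_ge0 A_ge0)) AE lerDr sqr_ge0.
have [K KP] := gram_bounded.
have hi f : ipnorm (re_form A) f <= (K + eps) * ipnorm (re_form (dotp H)) f.
  have := KP f; have := ipnorm_ge0 (re_form gram) f.
  have := ipnorm_ge0 (re_form (dotp H)) f => b0 a0 ab.
  have c0 : 0 <= (K + eps) * ipnorm (re_form (dotp H)) f.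
    rewrite mulrDl; apply: addr_ge0; first exact: le_trans a0 ab.
    by rewrite mulr_ge0 // ltW.
  rewrite -(@ler_pXn2r _ 2)// ?nnegrE ?ipnorm_ge0//.
  rewrite (sqr_ipnorm (re_form_ge0 A_ge0)) AE mulrDl.
  have d0 : 0 <= eps * ipnorm (re_form (dotp H)) f by rewrite mulr_ge0// ltW.
  by move: (eps * _) (K * _) (ipnorm (re_form gram) f) d0 ab a0 => d c a *; nra.
apply: (form_riesz AC ADl AZl A_ge0 (l := fun h => dotp H h (p z))
  (L := eps^-1 * ipnorm (re_form (dotp H)) (p z))).
- exact: (ip_complete_equiv eps_gt0 lo hi (@rkhs_complete _ _ H)).
- by move=> u v; exact: dotpDl.
- by move=> c u; exact: dotpZl.
move=> u; apply: le_trans (form_cauchy_schwarz (@dotpC _ _ H) (@dotpDl _ _ H)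
  (@dotpZl _ _ H) (@dotp_ge0 _ _ H) _ _) _.
by rewrite mulrAC ler_wpM2r ?ipnorm_ge0// mulrC ler_pdivlMr// mulrC.
Qed.

Lemma weak_solution_unique u v : weak_solution u -> weak_solution v -> u = v.
Proof.
move=> su sv; pose w := u - v.
suff w0 : ipnorm (re_form (dotp H)) w = 0.
  by apply/eqP; rewrite -subr_eq0 -/w -normr_eq0 norm_rkhsE w0.
have dotpBr (f h k : H) : dotp H f (h - k) = dotp H f h - dotp H f k.
  by rewrite dotpC -scaleN1r dotpDl dotpZl conjcD conjcM
    -!dotpC (rmorphN (@conjc R)) rmorph1 mulN1r.
have gramBr f h k : gram f (h - k) = gram f h - gram f k.
  by rewrite gramC -scaleN1r gramDl gramZl conjcD conjcM
    -!gramC (rmorphN (@conjc R)) rmorph1 mulN1r.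
(* The two equations are subtracted and tested on the difference [w] itself; both terms are
   nonnegative, so both vanish. *)
have : gram w w + (eps ^+ 2)%:C * dotp H w w = 0.
  rewrite {2 4}/w dotpBr gramBr mulrBr addrACA -opprD -su -sv subrr.
  by [].
rewrite (form_diagE gramC gram_ge0) (form_diagE (@dotpC _ _ H) (@dotp_ge0 _ _ H)).
rewrite -rmorphM -rmorphD => /complexI/eqP.
rewrite paddr_eq0 ?sqr_ge0 ?(mulr_ge0 (sqr_ge0 _) (sqr_ge0 _))// => /andP[_].
by rewrite mulf_eq0 !sqrf_eq0 gt_eqF//= => /eqP.
Qed.

(** By Hermitian symmetry p(zeta, tau) is the conjugate of p_zeta(tau), so the integral is an
    L^2(Gamma) product with p_zeta. *)
Lemma integral_operatorE u zeta : Omega zeta ->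
  integral_operator p G u zeta = gram u (p zeta).
Proof.
move=> Oz; apply: eq_arc_integral => t /G_Omega Dt.
by rewrite /Defs.kernel [feval (p _) zeta]p_kernel// dotpC -p_kernel// mulrC.
Qed.

(** The equation at zeta is the conjugate of the weak one tested on p_zeta. *)
Lemma solves_equationP u : solves_equation p G eps z u <-> weak_solution u.
Proof.
have cR (r : R) : (r%:C)^*%C = r%:C by exact: conjc_real.
split=> [su h|su zeta Oz]; last first.
  rewrite integral_operatorE// /Defs.kernel [feval (p z) _]p_kernel// [RHS]dotpC su.
  by rewrite conjcD conjcM cR -gramC -dotpC -p_kernel.
have [k kP] := gram_riesz u.
(* With [k] representing K u in H, the pointwise equation becomes an identity of elements of H,
   which can be paired with any [h]. *)
suff <- : k + (eps ^+ 2)%:C *: u = p z.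
  rewrite kP dotpC dotpDl dotpZl conjcD conjcM cR.
  by rewrite -!dotpC.
apply: feval_inj => w Ow; rewrite fevalD// fevalZ//.
by rewrite -[feval (p z) w]/(Defs.kernel p w z) -su// integral_operatorE// gramC kP
  -dotpC p_kernel.
Qed.

End gram.

(** The real arithmetic of the bound, with a = |u| and b = |u|_Gamma. *)
Lemma fine_scaling (R : realType) (a b eps : R) : 0 <= a -> 0 <= b -> 0 < eps ->
  (a = 0 -> b = 0) ->
  let m := fine (mine (a%:E^-1) (eps%:E / b%:E))%E in
  [/\ 0 <= m, m * a <= 1, m * b <= eps &
   eps * b + eps ^+ 2 * a <= 3 / 2 * (b ^+ 2 + eps ^+ 2 * a ^+ 2) * m].
Proof.
move=> a0 b0 e0 ab m; rewrite /m !inver.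
(* Here both terms of the minimum are +oo, [fine] returns 0, and every inequality is trivial. *)
have [aE|aN] := eqVneq a 0.
  rewrite aE (ab aE) eqxx gt0_muley ?lte_fin// minxx /=.
  by rewrite !mulr0 ?addr0; split => //; exact: ltW.
have {a0 aN ab}a0 : 0 < a by rewrite lt_def aN.
(* Now [eps / 0] is +oo and the minimum is [a^-1]. *)
have [->|bN] := eqVneq b 0.
  rewrite gt0_muley ?lte_fin// min_l ?leey//= expr0n/= !mulr0 !add0r.
  split; rewrite ?mulVf ?gt_eqF//; [by rewrite invr_ge0 ltW|exact: ltW|].
  rewrite [leRHS](_ : _ = 3 / 2 * (eps ^+ 2 * a)); last by field; rewrite gt_eqF.
  have : 0 < eps ^+ 2 * a by rewrite mulr_gt0 ?exprn_gt0.
  by lra.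
have {b0 bN}b0 : 0 < b by rewrite lt_def bN.
rewrite -EFinM -EFin_min /=.
(* This yields the last inequality in both cases, through [3/2 (1 + x^2) - (1 + x) = 1/2 (1 - x)^2 +
   x^2]. *)
have pos := sqr_ge0 (b - eps * a).
have [le|/ltW le] := leP a^-1 (eps / b).
  have le' : b <= eps * a.
    by move: le; rewrite ler_pdivlMr// mulrC ler_pdivrMr.
  split; first by rewrite invr_ge0 ltW.
  - by rewrite mulVf ?gt_eqF.
  - by rewrite mulrC ler_pdivrMr// mulrC.
  - by rewrite ler_pdivlMr//; nra.
have le' : eps * a <= b.
  by move: le; rewrite ler_pdivrMr// mulrC ler_pdivlMr.
split.
- by rewrite ltW ?divr_gt0.
- by rewrite mulrAC ler_pdivrMr// mul1r.
- by rewrite divfK ?gt_eqF.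
- by rewrite mulrA ler_pdivlMr//; nra.
Qed.

Unset Implicit Arguments.
Set Strict Implicit.

Theorem theorem3p4 (R : realType) (Omega : set R[i]) (H : rkhs Omega)
    (p : R[i] -> H) (Gamma : rectifiable_curve R) (eps : R) (z : R[i])
    (Omega_domain : domain Omega)
    (H_analytic : forall f : H, analytic_on Omega (feval f))
    (p_kernel : reproducing_kernel p)
    (Gamma_Omega : compactly_contained Gamma Omega)
    (eps_gt0 : 0 < eps)
    (Omega_z : Omega z) (Gamma_z : ~ cclosure Gamma z) :
  (exists! u : H, solves_equation p Gamma eps z u) /\
  forall u : H, solves_equation p Gamma eps z u ->
  let m := (scaling Gamma eps u)%:C in
  let bound := 3 / 2 * feval u z * m in
  (forall f : H, `|f| <= 1 -> (L2norm Gamma (feval f) <= eps%:E)%E ->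
     `|feval f z| <= bound) /\
  (exists M : H,
     [/\ forall zeta, Omega zeta -> feval M zeta = feval u zeta * m,
         `|M| <= 1,
         (L2norm Gamma (feval M) <= eps%:E)%E
       & feval M z = bound / (3 / 2)]).
Proof.
have [cptG GO] := Gamma_Omega.
have G_Omega t : curve_dom Gamma t -> Omega (curve_fun Gamma t).
  by move=> Dt; apply/GO/subset_closure; exists t.
(* Analytic functions are continuous on the compact closure of the curve. *)
have H_bounded (f : H) : curve_bounded Gamma (feval f).
  apply: continuous_curve_bounded => // w /GO Ow.
  exact/(@differentiable_continuous _ R[i]^o R[i]^o)/derivable1_diffP/H_analytic.
have solP := solves_equationP G_Omega H_bounded p_kernel eps z.
split.
  have [u uP] := weak_solution_exists G_Omega H_bounded p_kernel z eps_gt0.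
  exists u; split; first exact/solP.
  by move=> v /solP vP; apply: (weak_solution_unique G_Omega H_bounded eps_gt0 uP vP).
move=> u /solP uP m bound.
set N := ipnorm (re_form (dotp H)); set NG := ipnorm (re_form (@gram _ _ H Gamma)).
have evalE f : feval f z = gram Gamma f u + (eps ^+ 2)%:C * dotp H f u.
  by rewrite p_kernel.
have uzE : feval u z = (NG u ^+ 2 + eps ^+ 2 * N u ^+ 2)%:C.
  rewrite evalE (form_diagE (gramC H_bounded) (gram_ge0 Gamma)).
  by rewrite (form_diagE (@dotpC _ _ H) (@dotp_ge0 _ _ H)) -rmorphM -rmorphD.
(* Ensures that when [u = 0] both terms of the minimum degenerate together. *)
have u0 : N u = 0 -> NG u = 0.
  have [K KP] := gram_bounded G_Omega H_bounded p_kernel.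
  move=> Nu0; apply/eqP; rewrite eq_le ipnorm_ge0 andbT.
  by have := KP u; rewrite -/N Nu0 mulr0.
have N_ge0 f : 0 <= N f by exact: ipnorm_ge0.
have NG_ge0 f : 0 <= NG f by exact: ipnorm_ge0.
have [m_ge0 mN mNG mb] := fine_scaling (N_ge0 u) (NG_ge0 u) eps_gt0 u0.
have mE : scaling Gamma eps u = fine (mine ((N u)%:E^-1) (eps%:E / (NG u)%:E))%E.
  by rewrite /scaling norm_rkhsE (L2norm_gram H_bounded).
rewrite -mE in m_ge0 mN mNG mb.
have mzE (r : R) : normc (r%:C) = `|r|.
  by rewrite /= expr0n addr0 sqrtr_sqr.
split=> [f|].
  rewrite norm_rkhsE -(rmorph1 (real_complex R)) lecR => f1.
  rewrite (L2norm_gram H_bounded) lee_fin => fG.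
  have -> : bound = (3 / 2 * (NG u ^+ 2 + eps ^+ 2 * N u ^+ 2) *
      scaling Gamma eps u)%:C.
    by rewrite /bound uzE !rmorphM /= fmorphV !rmorph_nat.
  rewrite normr_normc lecR; apply: le_trans mb.
  rewrite evalE; apply: le_trans (le_normcD _ _) _.
  rewrite ComplexField.Normc.normcM mzE ger0_norm ?sqr_ge0//; apply: lerD.
    apply: le_trans (form_cauchy_schwarz (gramC H_bounded)
      (gramDl G_Omega H_bounded) (gramZl G_Omega H_bounded) (gram_ge0 Gamma) _ _) _.
    by rewrite ler_wpM2r ?ipnorm_ge0.
  rewrite ler_wpM2l ?sqr_ge0//.
  apply: le_trans (form_cauchy_schwarz (@dotpC _ _ H) (@dotpDl _ _ H)
    (@dotpZl _ _ H) (@dotp_ge0 _ _ H) _ _) _.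
  by rewrite -[leRHS]mul1r ler_wpM2r ?ipnorm_ge0.
(* The two norm bounds are [mN] and [mNG], as [m] is a nonnegative real. *)
exists (m *: u); split.
- by move=> zeta Oz; rewrite fevalZ// mulrC.
- rewrite norm_rkhsE -(rmorph1 (real_complex R)) lecR.
  by rewrite (ipnorm_re_formZ (@dotpC _ _ H) (@dotpZl _ _ H) (@dotp_ge0 _ _ H))
    mzE ger0_norm.
- rewrite (L2norm_gram H_bounded) lee_fin.
  by rewrite (ipnorm_re_formZ (gramC H_bounded) (gramZl G_Omega H_bounded)
    (gram_ge0 Gamma)) mzE ger0_norm.
by rewrite fevalZ// /bound; field.
Qed.
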